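(* Let $G$ be a group with a finite generating set $S\subset G$. For every $R\in[0,\infty)\cap\mathbb{Z}$ and every smooth function $f:B(3R)\to\mathbb{R}$, $$\int_{B(R)}|f-f_R|^2\;\le\;8\,|S|^2\,R^2\,\frac{V(2R)}{V(R)}\int_{B(3R)}|\nabla f|^2,$$ where $f_R$ is the average of $f$ over $B(R)$.
   Context: $|g|$ denotes the word norm of $g\in G$ with respect to $S$, and for a nonnegative integer $R$, $V(R)=|B_G(R)|$ is the number of elements $g\in G$ with $|g|\le R$. The Cayley graph of $(G,S)$ has vertex set $G$, with an edge joining $g$ and $gs$ for $g\in G$, $s\in S$; it is viewed as (the geometric realization of) a $1$-dimensional simplicial complex with all edges of length $1$ and the path metric. $B(R)=B(e,R)$ is the closed $R$-ball about the identity vertex in this metric graph (a $1$-dimensional set, not a discrete one). Integrals are with respect to arclength on edges. A smooth function on a ball is a continuous function which is smooth along each (closed) edge, and $|\nabla f|$ is the absolute value of the derivative of $f$ along edges. The average of $f$ over $B(R)$ is $\int_{B(R)}f$ divided by the total length of $B(R)$ (for $R=0$ both sides of the inequality are understood to be $0$). *)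

(* Defs.v *)
From mathcomp Require Import all_boot all_order all_algebra finmap.
From mathcomp Require Import all_classical all_reals all_analysis.
Set Implicit Arguments.
Unset Strict Implicit.
Unset Printing Implicit Defensive.
Import Order.TTheory GRing.Theory Num.Theory.
Import numFieldNormedType.Exports.
Local Open Scope classical_set_scope.
Local Open Scope ring_scope.

Section WordNorm.
Variables (G : groupType) (S : {fset G}).

(* [S] is not assumed symmetric: words are written in S and its inverses. *)
Definition word_for (w : seq G) (g : G) : Prop :=
  all (fun s => (s \in S) || ((s^-1)%g \in S)) w /\ (\prod_(s <- w) s)%g = g.

Definition generates : Prop := forall g : G, exists w : seq G, word_for w g.

(* Minimal length of a word for [g]; the default 0 is only used when [g] is
   not in the subgroup generated by [S]. *)
Definition word_norm (g : G) : nat :=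
  xget 0%N [set n : nat | (exists2 w, word_for w g & size w = n) /\
                          (forall w, word_for w g -> (n <= size w)%N)].

Definition volume (n : nat) : nat :=
  #|` fset_set [set g : G | (word_norm g <= n)%N]|.

(* Unoriented adjacency; as the Cayley graph is a simplicial complex it has no
   loops, and at most one edge joins two given vertices. *)
Definition cayley_adj (g h : G) : Prop :=
  g != h /\ exists2 s, s \in S & h = (g * s)%g \/ g = (h * s)%g.

End WordNorm.

Section CayleyGraph.
Variables (K : realType) (G : groupType) (S : {fset G}).

(* Points of the geometric realization are given by their barycentric
   coordinates, that is, as functions G -> K. *)
Definition vertex (g : G) : G -> K := fun k => (k == g)%:R.

Definition edge_point (g h : G) (t : K) : G -> K :=
  fun k => (1 - t) * vertex g k + t * vertex h k.

Definition realization : set (G -> K) :=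
  [set x | (exists g, x = vertex g) \/
           (exists g h t, [/\ cayley_adj S g h, 0 <= t <= 1 &
                              x = edge_point g h t])].

(* [pl_path x y l]: a piecewise linear path of length [l] from [x] to [y],
   each of its pieces being a segment of a closed edge of length 1. *)
Inductive pl_path : (G -> K) -> (G -> K) -> K -> Prop :=
| pl_path_nil x : realization x -> pl_path x x 0
| pl_path_cons g h t u y l :
    cayley_adj S g h -> 0 <= t <= 1 -> 0 <= u <= 1 ->
    pl_path (edge_point g h u) y l ->
    pl_path (edge_point g h t) y (`|t - u| + l).

Definition path_dist (x y : G -> K) : K := inf [set l | pl_path x y l].

(* Closed ball about the identity vertex. *)
Definition cayley_ball (r : K) : set (G -> K) :=
  [set x | realization x /\ path_dist (vertex 1%g) x <= r].

(* Integral over A, with respect to arclength, of a function F given in edge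
   coordinates: F g h t is its value at [edge_point g h t]. Vertices have
   arclength 0, so only open edges are integrated over. The sum is over oriented
   edges, hence the factor 1/2. It is finitely supported when A is bounded and
   S is finite; [\sum_(_ \in _)] is 0 for infinitely supported families. *)
Definition edge_integral (A : set (G -> K)) (F : G -> G -> K -> K) : K :=
  2^-1 * \sum_(e \in [set e : G * G | cayley_adj S e.1 e.2])
           \int[lebesgue_measure]_(t in [set t : K | 0 < t < 1 /\
                                          A (edge_point e.1 e.2 t)])
             F e.1 e.2 t.

Definition arclength_integral (A : set (G -> K)) (F : (G -> K) -> K) : K :=
  edge_integral A (fun g h t => F (edge_point g h t)).

Definition total_length (A : set (G -> K)) : K :=
  arclength_integral A (fun=> 1).

Definition average (A : set (G -> K)) (f : (G -> K) -> K) : K :=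
  arclength_integral A f / total_length A.

(* |grad f| in edge coordinates; independent of the orientation of the edge. *)
Definition grad_norm (f : (G -> K) -> K) (g h : G) (t : K) : K :=
  `| derive1 (fun u : K => f (edge_point g h u)) t |.

Definition continuous_on (A : set (G -> K)) (f : (G -> K) -> K) : Prop :=
  forall x, A x -> forall eps : K, 0 < eps ->
    exists2 delta : K, 0 < delta &
      forall y, A y -> path_dist x y < delta -> `|f x - f y| < eps.

Definition smooth_fun (phi : K -> K) : Prop :=
  forall (n : nat) (t : K), derivable (derive1n n phi) t 1.

(* Only the values of f on A matter. Smoothness on a closed edge means being the
   restriction of a smooth function of the edge parameter. *)
Definition smooth_on (A : set (G -> K)) (f : (G -> K) -> K) : Prop :=
  continuous_on A f /\
  forall g h, cayley_adj S g h ->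
    (forall t, 0 <= t <= 1 -> A (edge_point g h t)) ->
    exists2 phi : K -> K, smooth_fun phi &
      forall t, 0 <= t <= 1 -> f (edge_point g h t) = phi t.

End CayleyGraph.

(* Main.v *)
Require Import Defs.
From mathcomp Require Import all_boot all_order all_algebra finmap.
From mathcomp Require Import all_classical all_reals all_analysis.
From mathcomp Require Import ring lra zify.
Set Implicit Arguments.
Unset Strict Implicit.
Unset Printing Implicit Defensive.
Import Order.TTheory GRing.Theory Num.Theory.
Import numFieldNormedType.Exports.
Local Open Scope ring_scope.

(** Write [U] for the restriction of [f] to vertices, and [D] for the sum over the
    oriented edges of the ball of radius [3 * R] of the integral of the squared
    gradient, that is, twice the integral of the theorem.

    On vertices the inequality is Kleiner's argument ([discrete_poincare]). The
    sum of the squared deviations of [U] from its mean over the ball of radius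
    [R] is, up to a factor, the sum of [(U z - U x) ^+ 2] over pairs of points of
    that ball. Put [z = x * y], so that [y] has norm at most [2 * R], and follow
    from [x] a word of minimal length for [y], chosen once and for all.
    Cauchy-Schwarz bounds [(U (x * y) - U x) ^+ 2] by the length of the word
    times the sum of the squared increments along its steps. For a fixed [y] and
    a fixed step, the oriented edge which is crossed determines [x]; summing over
    [x] thus gives at most the total over all oriented edges. The path has at
    most [2 * R] steps, and there are at most [volume S (2 * R)] elements [y], so
    the deviation is at most [2 * R ^ 2 * (volume S (2 * R) / volume S R) * D].

    Passing to the metric graph costs a factor [|S|] and a lower order term. The
    average of [f] may be replaced by the mean of [U], as the average is the best
    constant ([sum_sqr_dev_average_le]). On each edge, [f] differs from its value
    at the tail by an amount which the energy of the edge controls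
    ([edge_sqr_dev_le]), and each vertex is the tail of at most [2 |S|] oriented
    edges ([sum_edge_tail_le]). The total fits under the constant 8 with one
    factor [|S|] to spare.

    Geometrically, what makes this a statement about finite sums is that a ball
    of integer radius is a union of closed edges, apart from the identity
    vertex ([edge_integral_ball]). *)

(** * Word norm and finiteness of balls *)

Section Words.
Variables (G : groupType) (S : {fset G}).

Lemma word_for_cat {w1 w2 : seq G} {g1 g2 : G} :
  word_for S w1 g1 -> word_for S w2 g2 -> word_for S (w1 ++ w2) (g1 * g2)%g.
Proof.
by move=> [S1 <-] [S2 <-]; split; [rewrite all_cat S1|rewrite big_cat].
Qed.

Lemma word_for_inv {w : seq G} {g : G} :
  word_for S w g -> exists2 w', word_for S w' (g^-1)%g & size w' = size w.
Proof.
elim: w g => [|s w IHw] g [].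
  by rewrite big_nil => _ <-; exists [::] => //; split; rewrite ?big_nil ?invg1.
rewrite big_cons /= => /andP[Ss Sw] <-.
have [w' [Sw' Ew'] szw'] := IHw _ (conj Sw erefl).
exists (w' ++ [:: s^-1%g]); last by rewrite size_cat szw' addn1.
rewrite invgM; apply: word_for_cat => //; split; last by rewrite big_seq1.
by rewrite /= invgK andbT orbC.
Qed.

Lemma word_norm_le {w : seq G} {g : G} :
  word_for S w g -> (word_norm S g <= size w)%N.
Proof.
move=> Sw; rewrite /word_norm; case: xgetP => //= n _ [_]; exact.
Qed.

Hypothesis genS : generates S.

(** Generation rules out the default value in the definition of the norm. *)
Lemma word_norm_attained (g : G) :
  exists2 w, word_for S w g & size w = word_norm S g.
Proof.
have exP : exists n, `[< exists2 w, word_for S w g & size w = n >].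
  by have [w Sw] := genS g; exists (size w); apply/asboolP; exists w.
suff /(xgetPex 0%N)[] : exists n,
  (exists2 w, word_for S w g & size w = n) /\
  (forall w, word_for S w g -> (n <= size w)%N) by [].
case: (ex_minnP exP) => n /asboolP Pn minn; exists n; split=> // w Sw.
by apply/minn/asboolP; exists w.
Qed.

Lemma word_norm1 : word_norm S 1%g = 0%N.
Proof.
apply/eqP; rewrite -leqn0; apply: (@word_norm_le [::]).
by split; rewrite ?big_nil.
Qed.

Lemma word_normM (g h : G) :
  (word_norm S (g * h)%g <= word_norm S g + word_norm S h)%N.
Proof.
have [v Sv <-] := word_norm_attained g; have [w Sw <-] := word_norm_attained h.
by rewrite -size_cat; apply/word_norm_le/word_for_cat.
Qed.

Lemma word_normV (g : G) : (word_norm S (g^-1)%g <= word_norm S g)%N.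
Proof.
have [w Sw <-] := word_norm_attained g.
by have [w' Sw' <-] := word_for_inv Sw; apply: word_norm_le.
Qed.

Definition letter : pred G := fun s => (s \in S) || ((s^-1)%g \in S).

Lemma cayley_adjP (g h : G) :
  cayley_adj S g h <-> g != h /\ letter (g^-1 * h)%g.
Proof.
split=> -[gh]; last first.
  move=> /orP[] Ss; split=> //.
    by exists (g^-1 * h)%g => //; left; rewrite mulVKg.
  by exists (g^-1 * h)^-1%g => //; right; rewrite invgM invgK mulVKg.
move=> [s Ss E]; split=> //; apply/orP; case: E => ->.
  by left; rewrite mulKg.
by right; rewrite invgM invgK mulKg.
Qed.

Lemma cayley_adj_sym (g h : G) : cayley_adj S g h -> cayley_adj S h g.
Proof.
by move=> [gh [s Ss E]]; split; [rewrite eq_sym|exists s; tauto].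
Qed.

Lemma word_norm_letter (g s : G) :
  letter s -> (word_norm S (g * s)%g <= (word_norm S g).+1)%N.
Proof.
move=> Ss; apply: leq_trans (word_normM _ _) _; rewrite -addn1 leq_add2l.
apply: (@word_norm_le [:: s]).
by split; rewrite /= ?big_seq1 ?andbT.
Qed.

Lemma word_norm_adj (g h : G) :
  cayley_adj S g h -> (word_norm S h <= (word_norm S g).+1)%N.
Proof.
by move=> /cayley_adjP[_ /(word_norm_letter g)]; rewrite mulVKg.
Qed.

Definition letters : {fset G} := (S `|` [fset (s^-1)%g | s in S])%fset.

Lemma in_letters (s : G) : (s \in letters) = letter s.
Proof.
rewrite inE /letter; congr (_ || _); apply/imfsetP/idP => /=.
  by move=> [t St ->]; rewrite invgK.
by move=> Ss; exists (s^-1)%g; rewrite ?invgK.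
Qed.

Lemma card_letters : (#|` letters| <= 2 * #|` S|)%N.
Proof.
rewrite mul2n -addnn; apply: leq_trans (leq_card_fsetU _ _).1 _.
by rewrite leq_add2l leq_imfset_card.
Qed.

(** Volumes and finite sums over balls are those of [fset_set], which is empty on
    infinite sets, so this finiteness underlies everything that follows. *)
Lemma finite_ball (n : nat) : finite_set [set g | (word_norm S g <= n)%N].
Proof.
elim: n => [|n IHn].
  apply: (@sub_finite_set _ _ [set 1%g]) => // g /=; rewrite leqn0 => /eqP g0.
  have [w [_ Ew] szw] := word_norm_attained g.
  by move: szw Ew; rewrite {}g0 => /size0nil ->; rewrite big_nil.
have fP := finite_setX IHn (finite_fset (1%g |` letters)%fset).
apply: sub_finite_set (finite_image (fun p => p.1 * p.2)%g fP) => g /= gn.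
have [w] := word_norm_attained g.
case: (lastP w) => [[_ Eg] szw|{}w s [Sw Eg] szw].
  by exists (g, 1%g); rewrite /= ?mulg1 // -szw !inE eqxx; split.
move: Sw Eg szw; rewrite all_rcons -cats1 big_cat big_seq1 size_cat addn1 /=.
move=> /andP[Ss Sw] Eg szw; exists ((\prod_(t <- w) t)%g, s) => //=.
split; last by rewrite in_fset1U in_letters /letter Ss orbT.
have : (size w <= n)%N by rewrite -ltnS szw.
by apply: leq_trans; apply: word_norm_le.
Qed.

Definition ball_fset (n : nat) : {fset G} :=
  fset_set [set g | (word_norm S g <= n)%N].

Lemma in_ball_fset (n : nat) (g : G) :
  (g \in ball_fset n) = (word_norm S g <= n)%N.
Proof. by rewrite in_fset_set; [apply/asboolP/idP|exact: finite_ball]. Qed.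

End Words.

(** * Balls of the geometric realization *)

Section Realization.
Variables (K : realType) (G : groupType) (S : {fset G}).

Lemma edge_point0 (g h : G) : edge_point g h 0 = vertex K g.
Proof. by apply/funext => k; rewrite /edge_point subr0 mul1r mul0r addr0. Qed.

Lemma edge_point1 (g h : G) : edge_point g h 1 = vertex K h.
Proof. by apply/funext => k; rewrite /edge_point subrr mul1r mul0r add0r. Qed.

Lemma edge_pointC (g h : G) (t : K) : edge_point g h t = edge_point h g (1 - t).
Proof. by apply/funext => k; rewrite /edge_point; ring. Qed.

Lemma realization_edge_point (g h : G) (t : K) :
  cayley_adj S g h -> 0 <= t <= 1 -> realization S (edge_point g h t).
Proof. by move=> gh t01; right; exists g, h, t. Qed.

Lemma pl_path_ge0 {x y : G -> K} {l : K} : pl_path S x y l -> 0 <= l.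
Proof. by elim=> // *; rewrite addr_ge0. Qed.

Lemma path_dist_le {x y : G -> K} {l : K} :
  pl_path S x y l -> path_dist S x y <= l.
Proof. by move=> xyl; apply: ge_inf xyl; exists 0 => l' /pl_path_ge0. Qed.

(** Lower bounds on distances come from this, applied to the potential below. *)
Lemma pl_path_lipschitz (tau : (G -> K) -> K) :
    (forall g h t u, cayley_adj S g h -> 0 <= t <= 1 -> 0 <= u <= 1 ->
      tau (edge_point g h u) - tau (edge_point g h t) <= `|t - u|) ->
  forall x y l, pl_path S x y l -> tau y - tau x <= l.
Proof.
move=> tau_lip x y l; elim=> [z _|g h t u z m gh t01 u01 _ IH].
  by rewrite subrr.
by have := tau_lip _ _ _ _ gh t01 u01; lra.
Qed.

(** The letter 1 moves nowhere and crosses no edge, hence an inequality. *)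
Lemma pl_path_word (w : seq G) (g : G) (y : G -> K) (l : K) :
    all (letter S) w -> pl_path S (vertex K (g * \prod_(s <- w) s)%g) y l ->
  exists2 l', pl_path S (vertex K g) y l' & l' <= (size w)%:R + l.
Proof.
elim: w g => [|s w IHw] g /=.
  by rewrite big_nil mulg1 => _ gyl; exists l => //; rewrite add0r.
rewrite big_cons mulgA => /andP[Ss Sw] /(IHw _ Sw)[l' gs_y ll'].
have [s1|s_neq1] := eqVneq s 1%g.
  by exists l'; [rewrite s1 mulg1 in gs_y|move: ll'; rewrite -natr1; lra].
have g_gs : cayley_adj S g (g * s)%g.
  apply/cayley_adjP; rewrite mulKg; split=> //.
  by apply: contra s_neq1 => /eqP E; apply/eqP/(mulgI g); rewrite mulg1.
have := @pl_path_cons _ _ _ g (g * s)%g 0 1 y l' g_gs.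
rewrite edge_point0 edge_point1 !lexx ler01 => /(_ isT isT gs_y) g_y.
by exists (`|0 - 1| + l') => //; rewrite sub0r normrN1 -natr1; lra.
Qed.

Hypothesis genS : generates S.

Lemma pl_path_edge_point (g h : G) (t : K) :
    cayley_adj S g h -> 0 <= t <= 1 ->
  exists2 l, pl_path S (vertex K 1%g) (edge_point g h t) l &
    l <= (word_norm S g)%:R + t.
Proof.
move=> gh t01; have [w [Sw wg] szw] := word_norm_attained genS g.
have z01 : 0 <= (0 : K) <= 1 by rewrite lexx ler01.
have P := pl_path_cons gh z01 t01 (pl_path_nil (realization_edge_point gh t01)).
rewrite edge_point0 -{1}wg -[(\prod_(s <- w) s)%g]mul1g in P.
have [l lP le_l] := pl_path_word Sw P.
exists l => //; move: le_l t01; rewrite szw sub0r normrN => le_l /andP[t0 _].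
by move: le_l; rewrite ger0_norm // addr0.
Qed.

(** This and [edge_point_notin_ball] show that a ball of integer radius is a
    subcomplex: it contains an open edge entirely or not at all, according to
    whether an endpoint has norm less than the radius. *)
Lemma edge_point_in_ball (g h : G) (t : K) (n : nat) :
    cayley_adj S g h -> (word_norm S g < n)%N || (word_norm S h < n)%N ->
  0 <= t <= 1 -> cayley_ball S n%:R (edge_point g h t).
Proof.
wlog gn : g h t / (word_norm S g < n)%N => [wlg|] gh.
  case/orP=> [gn|hn] t01; first by apply: wlg => //; rewrite gn.
  rewrite edge_pointC; apply: wlg; rewrite ?hn //; last by lra.
  exact: cayley_adj_sym.
move=> _ t01; split; first exact: realization_edge_point.
have [l lP le_l] := pl_path_edge_point gh t01.
have := path_dist_le lP; move: gn; rewrite -(ler_nat K) -natr1; lra.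
Qed.

Lemma fsbig_edge_point (c : G -> K) (g h : G) (t : K) : g != h ->
  \sum_(k \in [set: G]) edge_point g h t k * c k = (1 - t) * c g + t * c h.
Proof.
move=> gh; rewrite -(@fsbig_widen _ _ _ _ [set` [fset g; h]%fset]) //.
  rewrite fsbig_finite ?set_fsetK; last exact: finite_fset.
  rewrite big_fsetU1 ?inE //= big_seq_fset1 /edge_point /vertex !eqxx.
  by rewrite (negPf gh) eq_sym (negPf gh) !mulr0 !mulr1 add0r addr0.
move=> k [_ /=]; rewrite /edge_point /vertex !inE => /negP.
by rewrite negb_or => /andP[/negPf-> /negPf->]; rewrite !mulr0 add0r mul0r.
Qed.

(** At the identity vertex this potential is 0, while on the open edge [{g, h}]
    it exceeds [n] as soon as neither endpoint has norm less than [n]: the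
    first summand, the linear interpolation of the norm truncated at [n], is
    then equal to [n], and the second is a tent over that edge which vanishes on
    all others. Truncation makes the first summand constant on the edge where
    the second one varies, so that the sum is still 1-Lipschitz along edges. *)
Definition potential (n : nat) (g h : G) (x : G -> K) : K :=
  \sum_(k \in [set: G]) x k * (minn (word_norm S k) n)%:R
  + Num.min (x g) (x h).

Lemma potential_edge_point (n : nat) (g h a b : G) (t : K) : a != b ->
  potential n g h (edge_point a b t) =
  (1 - t) * (minn (word_norm S a) n)%:R + t * (minn (word_norm S b) n)%:R
  + Num.min (edge_point a b t g) (edge_point a b t h).
Proof. by move=> ab; rewrite /potential fsbig_edge_point. Qed.

Lemma tent_lipschitz (t u : K) :
  Num.min (1 - u) u - Num.min (1 - t) t <= `|t - u|.
Proof.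
case: (leP (1 - u) u) => ?; case: (leP (1 - t) t) => ?;
by case: (ger0P (t - u)); lra.
Qed.

Lemma min_edge_point (a b : G) (t : K) : a != b ->
  Num.min (edge_point a b t a) (edge_point a b t b) = Num.min (1 - t) t.
Proof.
move=> /negPf ab; rewrite /edge_point /vertex !eqxx ab eq_sym ab.
by rewrite !mulr0 !mulr1 addr0 add0r.
Qed.

Lemma potential_lipschitz (n : nat) (g h : G) : g != h ->
    (n <= word_norm S g)%N -> (n <= word_norm S h)%N ->
  forall a b t u, cayley_adj S a b -> 0 <= t <= 1 -> 0 <= u <= 1 ->
    potential n g h (edge_point a b u) - potential n g h (edge_point a b t)
      <= `|t - u|.
Proof.
move=> gh ng nh a b t u adj_ab t01 u01; have ab := adj_ab.1.
rewrite !potential_edge_point //.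
have [gh_ab|gh_neq] := pselect ((g = a /\ h = b) \/ (g = b /\ h = a)).
  have [na nb tentE] : [/\ (n <= word_norm S a)%N, (n <= word_norm S b)%N &
      forall v, Num.min (edge_point a b v g) (edge_point a b v h)
                = Num.min (1 - v) v :> K].
    case: gh_ab => -[<- <-]; split=> // v; first by rewrite min_edge_point.
    by rewrite minC min_edge_point // eq_sym.
  rewrite !tentE !(minn_idPr _) //.
  by have := tent_lipschitz t u; lra.
have edge_coord_ge0 v k : 0 <= v <= 1 -> 0 <= edge_point a b v k :> K.
  by move=> ?; rewrite /edge_point /vertex addr_ge0 // mulr_ge0 ?ler0n //; lra.
have min0 v : 0 <= v <= 1 ->
    Num.min (edge_point a b v g) (edge_point a b v h) = 0 :> K.
  move=> v01.
  suff [g0|h0] : edge_point a b v g = 0 :> K \/ edge_point a b v h = 0 :> K.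
  - by rewrite g0 min_l ?edge_coord_ge0.
  - by rewrite h0 min_r ?edge_coord_ge0.
  have coord0 k : k != a -> k != b -> edge_point a b v k = 0 :> K.
    move=> /negPf ka /negPf kb.
    by rewrite /edge_point /vertex ka kb !mulr0 addr0.
  have [ga|ga] := eqVneq g a.
    right; apply: coord0; first by rewrite eq_sym -ga.
    by apply/eqP => hb; apply: gh_neq; left.
  have [gb|gb] := eqVneq g b; last by left; apply: coord0.
  right; apply: coord0; last by rewrite eq_sym -gb.
  by apply/eqP => ha; apply: gh_neq; right.
rewrite !min0 //.
have ca_cb :
    `|(minn (word_norm S a) n)%:R - (minn (word_norm S b) n)%:R| <= 1 :> K.
  have := word_norm_adj genS adj_ab.
  have := word_norm_adj genS (cayley_adj_sym adj_ab).
  rewrite ler_norml => ba ab'; apply/andP; split.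
    by rewrite -subr_ge0 opprK addrAC subr_ge0 natr1 ler_nat; lia.
  by rewrite lerBlDr addrC natr1 ler_nat; lia.
set x := _%:R in ca_cb *; set y := _%:R in ca_cb *.
have -> : (1 - u) * x + u * y + 0 - ((1 - t) * x + t * y + 0)
    = (t - u) * (x - y).
  by ring.
apply: le_trans (ler_norm _) _; rewrite normrM ler_piMr //.
Qed.

Lemma edge_point_notin_ball (g h : G) (t : K) (n : nat) :
    cayley_adj S g h -> (n <= word_norm S g)%N -> (n <= word_norm S h)%N ->
  0 < t < 1 -> ~ cayley_ball S n%:R (edge_point g h t).
Proof.
move=> gh ng nh t01 [_]; apply/negP; rewrite -ltNge.
have t01' : 0 <= t <= 1 by lra.
(* The infimum of an empty set of lengths would be 0, so the lower bound on
   lengths needs a path to exist. *)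
have [l0 l0P _] := pl_path_edge_point gh t01'.
apply: (@lt_le_trans _ _ (potential n g h (edge_point g h t)
  - potential n g h (vertex K 1%g))); last first.
  apply: lb_le_inf; first by exists l0.
  by move=> l; apply/pl_path_lipschitz/potential_lipschitz; rewrite ?gh.1.
have [gh_neq _] := gh.
have tent_gt0 : 0 < Num.min (1 - t) t by rewrite lt_min; lra.
have -> : potential n g h (vertex K 1%g) = 0.
  (* The sum is evaluated on an edge point, so 1 is viewed as an end of some
     segment; any [k] different from 1 will do. *)
  have [k k1] : exists k : G, 1%g != k.
    have [g1|g1] := eqVneq g 1%g; last by exists g; rewrite eq_sym.
    by exists h; rewrite -g1.
  rewrite -(edge_point0 _ k) potential_edge_point // word_norm1 min0n.
  rewrite edge_point0 /vertex mulr0 mul0r !add0r.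
  have [g1|_] := eqVneq g 1%g; last by rewrite min_l ?ler0n.
  by rewrite -g1 eq_sym (negPf gh_neq) min_r ?ler0n.
rewrite potential_edge_point // min_edge_point // !(minn_idPr _) // subr0.
by lra.
Qed.

End Realization.

(** * Finite sums *)

Section FiniteSums.
Variable K : realType.

(** All counting arguments below are instances of this comparison: multiplicities
    are controlled by the injectivity of a reindexing. *)
Lemma ler_sum_fset_inj (I J : choiceType) (A : {fset I}) (B : {fset J})
    (phi : I -> J) (F : J -> K) :
    {in A &, injective phi} -> (forall j, 0 <= F j) ->
    (forall i, i \in A -> phi i \notin B -> F (phi i) = 0) ->
  \sum_(i <- A) F (phi i) <= \sum_(j <- B) F j.
Proof.
move=> phi_inj F0 FB.
set C := [fset phi i | i in A]%fset.
have -> : \sum_(i <- A) F (phi i) = \sum_(j <- C) F j by rewrite big_imfset.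
rewrite (big_fset_incl _ (fsubsetUl B C)); last first.
  move=> j; rewrite inE => /orP[->//|/imfsetP[i /= iA ->]]; exact: FB.
rewrite [leRHS](big_fsetID _ (mem C)) /=.
rewrite (_ : [fset x in (B `|` C)%fset | x \in C]%fset = C) ?lerDl ?sumr_ge0 //.
by apply/fsetP => j; rewrite !inE andb_orl andbb orbC andKb.
Qed.

Lemma sum_fset_const (I : choiceType) (A : {fset I}) (c : K) :
  \sum_(i <- A) c = #|` A|%:R * c.
Proof. by rewrite big_const_seq count_predT iter_addr addr0 mulr_natl. Qed.

(** Cauchy-Schwarz for a telescoping sum. *)
Lemma sqr_telescope_le (a : nat -> K) (n : nat) :
  (a n - a 0%N) ^+ 2 <= n%:R * \sum_(i < n) (a i.+1 - a i) ^+ 2.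
Proof.
elim: n => [|n IHn]; first by rewrite subrr expr0n mul0r.
rewrite big_ord_recr /=.
have [->|n_gt0] := posnP n; first by rewrite big_ord0 add0r mul1r.
set s := \sum_(i < n) _ in IHn *.
set p := a n - a 0%N in IHn; set q := a n.+1 - a n.
have -> : a n.+1 - a 0%N = p + q by rewrite /p /q; ring.
have n0 : 0 < n%:R :> K by rewrite ltr0n.
rewrite -(ler_pM2l n0) -[in leRHS]natr1.
have : 0 <= (p - n%:R * q) ^+ 2 by exact: sqr_ge0.
move: IHn n0; move: (n%:R : K) => N IHn N0; nra.
Qed.

(** This identity trades the mean for differences between pairs of points, which
    paths joining them can estimate. *)
Lemma sum_sqr_dev (I : choiceType) (A : {fset I}) (u : I -> K) :
  #|` A|%:R * \sum_(i <- A) (u i - (\sum_(j <- A) u j) / #|` A|%:R) ^+ 2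
  = 2^-1 * \sum_(i <- A) \sum_(j <- A) (u j - u i) ^+ 2.
Proof.
set N : K := #|` A|%:R; set m := (_ / N); set s := \sum_(j <- A) u j in m *.
pose q := \sum_(j <- A) u j ^+ 2.
have inner x : \sum_(j <- A) (u j - x) ^+ 2 = q + (- 2 * x * s + N * x ^+ 2).
  rewrite (eq_bigr (fun j => u j ^+ 2 + (- 2 * x * u j + x ^+ 2))); last first.
    by move=> j _; ring.
  by rewrite !big_split -mulr_sumr sum_fset_const.
under [in RHS]eq_bigr do rewrite inner.
rewrite inner (eq_bigr (fun i => q + (- 2 * s * u i + N * u i ^+ 2))); last first.
  by move=> i _; ring.
rewrite !big_split -!mulr_sumr sum_fset_const /= -/s -/q -/N /m.
have [N0|N0] := eqVneq N 0; last by field.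
have s0 : s = 0.
  move/eqP: N0; rewrite /N pnatr_eq0 cardfs_eq0 => /eqP A0.
  by rewrite /s A0 big_nil.
by rewrite N0 s0; ring.
Qed.

End FiniteSums.

(** * The inequality on vertices *)

Section DiscretePoincare.
Variables (K : realType) (G : groupType) (S : {fset G}).
Hypothesis genS : generates S.

(** The oriented edges whose points lie in the ball of radius [n]: each edge
    occurs once with either orientation. *)
Definition ball_edges (n : nat) : set (G * G) :=
  [set e | cayley_adj S e.1 e.2 /\
    ((word_norm S e.1 < n) || (word_norm S e.2 < n))%N].

Definition edge_fset (n : nat) : {fset G * G} := fset_set (ball_edges n).

Lemma finite_ball_edges (n : nat) : finite_set (ball_edges n).
Proof.
apply: (@sub_finite_set _ _ ([set g | (word_norm S g <= n)%N] `*`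
                             [set g | (word_norm S g <= n)%N])%classic).
  move=> [g h] [/= gh ghn]; split=> /=.
    by have := word_norm_adj genS (cayley_adj_sym gh); move: ghn; lia.
  by have := word_norm_adj genS gh; move: ghn; lia.
by apply: finite_setX; exact: finite_ball.
Qed.

Lemma in_edge_fsetP (n : nat) (e : G * G) :
  reflect (ball_edges n e) (e \in edge_fset n).
Proof. by rewrite in_fset_set; [exact: asboolP|exact: finite_ball_edges]. Qed.

Lemma edge_fsetS (m n : nat) :
  (m <= n)%N -> (edge_fset m `<=` edge_fset n)%fset.
Proof.
move=> mn; apply/fsubsetP => e /in_edge_fsetP[adj_e em].
by apply/in_edge_fsetP; split=> //; move: em; lia.
Qed.

(** Since an open edge lies in the ball or misses it, the domain of integration
    on each edge is the whole open interval or empty. *)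
Lemma edge_integral_ball (n : nat) (F : G -> G -> K -> K) :
  edge_integral S (cayley_ball S n%:R) F =
  2^-1 * \sum_(e <- edge_fset n)
           \int[lebesgue_measure]_(t in `]0, 1[%classic) F e.1 e.2 t.
Proof.
rewrite /edge_integral; congr (_ * _).
rewrite -(@fsbig_widen _ _ _ _ (ball_edges n)); [|by move=> e []|]; last first.
  move=> e /= [adj_e nE].
  rewrite (_ : [set _ | _] = set0)%classic ?Rintegral_set0 //.
  apply/seteqP; split=> // t /= [t01].
  apply: edge_point_notin_ball => //; rewrite leqNgt; apply/negP => lt_n;
    by apply: nE; split=> //; rewrite lt_n ?orbT.
rewrite fsbig_finite; last exact: finite_ball_edges.
rewrite big_seq [RHS]big_seq; apply: eq_bigr => e /in_edge_fsetP[adj_e en].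
congr Rintegral; apply/seteqP; split=> t /=; rewrite in_itv //=; first by case.
move=> t01; split=> //; apply: edge_point_in_ball => //; lra.
Qed.

(** The oriented edge from [x * g] to [x * g * s] determines [x], so distinct [x]
    use distinct oriented edges. Keeping orientations makes this true even when
    [s] is an involution. If [s] is 1 there is no edge, but then the left-hand
    side is 0. *)
Lemma sum_edge_translate_le (U : G -> K) (n R : nat) (g s : G) :
    letter S s -> (word_norm S g + R < n)%N ->
  \sum_(x <- ball_fset S R) (U (x * (g * s))%g - U (x * g)%g) ^+ 2
  <= \sum_(e <- edge_fset n) (U e.2 - U e.1) ^+ 2.
Proof.
move=> Ss gRn.
apply: (@ler_sum_fset_inj _ _ _ _ _ (fun x => (x * g, x * (g * s))%g)
  (fun e => (U e.2 - U e.1) ^+ 2)) => [x y _ _ [/mulIg]||x] //.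
  by move=> e; exact: sqr_ge0.
rewrite in_ball_fset // => xR.
have [s1 _|s1] := eqVneq s 1%g; first by rewrite s1 mulg1 subrr expr0n.
case/in_edge_fsetP; split => /=.
  apply/cayley_adjP; rewrite mulgA mulKg; split=> //.
  by apply: contra s1 => /eqP E; apply/eqP/(mulgI (x * g)%g); rewrite mulg1.
apply/orP; left; apply: leq_ltn_trans (word_normM genS x g) _; lia.
Qed.

(** From [x] in the ball of radius [R], the geodesic word of [y] is followed one
    letter at a time; step [i < 2 * R] starts within distance
    [R + i < 3 * R] of the identity, which is why the ball of radius [3 * R]
    appears. *)
Lemma sum_ball_translate_le (U : G -> K) (R : nat) (y : G) :
    (word_norm S y <= 2 * R)%N ->
  \sum_(x <- ball_fset S R) (U (x * y)%g - U x) ^+ 2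
  <= (2 * R)%:R ^+ 2 * \sum_(e <- edge_fset (3 * R)) (U e.2 - U e.1) ^+ 2.
Proof.
have [w [Sw <-] <-] := word_norm_attained genS y => szw.
set M := \sum_(e <- edge_fset _) _.
have M0 : 0 <= M by apply: sumr_ge0 => e _; exact: sqr_ge0.
pose p i := (\prod_(s <- take i w) s)%g.
apply: (@le_trans _ _ ((size w)%:R * \sum_(i < size w) M)); last first.
  rewrite sumr_const card_ord -[M *+ _]mulr_natl mulrA ler_wpM2r // -expr2.
  by rewrite ler_sqr ?nnegrE ?ler0n // ler_nat.
apply: (@le_trans _ _ (\sum_(x <- ball_fset S R) ((size w)%:R *
  \sum_(i < size w) (U (x * p i.+1)%g - U (x * p i)%g) ^+ 2))).
  apply: ler_sum => x _.
  have := sqr_telescope_le (fun i => U (x * p i)%g) (size w).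
  by rewrite /p take_size take0 big_nil mulg1.
rewrite -mulr_sumr ler_wpM2l // exchange_big; apply: ler_sum => i _ /=.
have -> : p i.+1 = (p i * nth 1 w i)%g.
  by rewrite /p (take_nth 1%g) // -cats1 big_cat big_seq1.
apply: sum_edge_translate_le; first by move/all_nthP: Sw; apply.
have : (word_norm S (p i) <= i)%N.
  apply: (@leq_trans (size (take i w))); last by rewrite size_take ltn_ord.
  apply: word_norm_le; split=> //; apply/allP => s /mem_take; exact: (allP Sw).
have := ltn_ord i; lia.
Qed.

Lemma volume_gt0 (n : nat) : (0 < volume S n)%N.
Proof.
rewrite cardfs_gt0; apply/fset0Pn; exists 1%g.
by rewrite in_ball_fset // word_norm1.
Qed.

Lemma volumeS (m n : nat) : (m <= n)%N -> (volume S m <= volume S n)%N.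
Proof.
move=> mn; apply/fsubset_leq_card/fsubsetP => g.
by rewrite !in_ball_fset // => /leq_trans; apply.
Qed.

(** Two points [x], [z] of the ball of radius [R] differ by [y = x^-1 * z], which
    lies in the ball of radius [2 * R]: the double sum over pairs becomes a sum
    over translations, and there are at most [volume S (2 * R)] of them. *)
Lemma discrete_poincare (U : G -> K) (R : nat) :
  \sum_(x <- ball_fset S R)
    (U x - (\sum_(y <- ball_fset S R) U y) / (volume S R)%:R) ^+ 2
  <= 2 * R%:R ^+ 2 * ((volume S (2 * R))%:R / (volume S R)%:R)
     * \sum_(e <- edge_fset (3 * R)) (U e.2 - U e.1) ^+ 2.
Proof.
set M := \sum_(e <- edge_fset _) _.
have V0 : 0 < (volume S R)%:R :> K by rewrite ltr0n volume_gt0.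
rewrite -(ler_pM2l V0) sum_sqr_dev.
have le_M : \sum_(x <- ball_fset S R) \sum_(y <- ball_fset S R) (U y - U x) ^+ 2
    <= (volume S (2 * R))%:R * ((2 * R)%:R ^+ 2 * M).
  apply: (@le_trans _ _ (\sum_(x <- ball_fset S R)
     \sum_(y <- ball_fset S (2 * R)) (U (x * y)%g - U x) ^+ 2)).
    rewrite big_seq [leRHS]big_seq; apply: ler_sum => x.
    rewrite in_ball_fset // => xR.
    rewrite (eq_bigr (fun y => (U (x * (x^-1 * y))%g - U x) ^+ 2)); last first.
      by move=> y _; rewrite mulVKg.
    apply: (@ler_sum_fset_inj _ _ _ _ _ (fun y => x^-1 * y)%g
      (fun y => (U (x * y)%g - U x) ^+ 2)) => [y z _ _ /mulgI||y] //.
      by move=> y; exact: sqr_ge0.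
    rewrite !in_ball_fset // => yR /negP[].
    apply: leq_trans (word_normM genS _ _) _.
    by have := word_normV genS x; move: xR yR; lia.
  rewrite exchange_big -sum_fset_const /= big_seq [leRHS]big_seq.
  apply: ler_sum => y; rewrite in_ball_fset //; exact: sum_ball_translate_le.
have -> : (volume S R)%:R * (2 * R%:R ^+ 2
    * ((volume S (2 * R))%:R / (volume S R)%:R) * M)
  = 2^-1 * ((volume S (2 * R))%:R * ((2 * R)%:R ^+ 2 * M)) :> K.
  by rewrite natrM; field; rewrite gt_eqF.
by rewrite ler_pM2l ?invr_gt0.
Qed.

End DiscretePoincare.

(** * Calculus on one edge *)

Section EdgeCalculus.
Variable K : realType.
Local Notation mu := (@lebesgue_measure K).

Lemma derivable_continuous_at (f : K -> K) :
  (forall t : K, derivable f t 1) -> continuous f.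
Proof. by move=> df t; apply/differentiable_continuous/derivable1_diffP. Qed.

Lemma continuous_sqr (f : K -> K) :
  continuous f -> continuous (fun t => f t ^+ 2).
Proof. by move=> cf t; apply: cvgM; exact: cf. Qed.

Lemma continuous_affine (f : K -> K) (a b : K) :
  continuous f -> continuous (fun t => a * f t + b).
Proof.
by move=> cf t; apply: cvgD; [apply: cvgMr; exact: cf|exact: cvg_cst].
Qed.

Lemma continuous_integrable_itv (f : K -> K) (a b : K) (ba bb : bool) :
  continuous f ->
  mu.-integrable [set` Interval (BSide ba a) (BSide bb b)] (EFin \o f).
Proof.
move=> cf; apply: (@integrableS _ _ _ mu `[a, b]%classic) => //.
  by apply: subset_itv; rewrite bnd_simp; case: ba bb => -[].
apply: continuous_compact_integrable; first exact: segment_compact.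
exact: continuous_subspaceT.
Qed.

Lemma Rintegral_derive1 (f F : K -> K) (a b : K) (ba bb : bool) :
    a < b -> continuous f -> (forall t : K, is_derive t 1 F (f t)) ->
  \int[mu]_(t in [set` Interval (BSide ba a) (BSide bb b)]) f t = F b - F a.
Proof.
move=> ab cf dF.
have mf := measurable_int mu (continuous_integrable_itv a b false true cf).
have cF : continuous F by apply: derivable_continuous_at => t; apply: ex_derive.
rewrite /Rintegral (integral_itv_bndoo ba bb mf).
rewrite -(integral_itv_bndoo true false mf) (continuous_FTC2 (F := F)) //.
- exact: continuous_subspaceT.
- split; first by move=> t _; apply: ex_derive.
  + exact/cvg_at_right_filter/cF.
  + exact/cvg_at_left_filter/cF.
- by move=> t _; rewrite derive1E; apply: derive_val.
Qed.

Variable phi : K -> K.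
Hypothesis dphi : forall t : K, derivable phi t 1.
Hypothesis cphi' : continuous (phi^`())%classic.

Let cphi : continuous phi.
Proof. exact: derivable_continuous_at. Qed.

Definition energy : K :=
  \int[mu]_(t in `]0, 1[%classic) (phi^`())%classic t ^+ 2.

(** Integrating [(phi' - l) ^+ 2] with [l] the slope of the chord gives the
    Cauchy-Schwarz inequality for [phi'] against 1. *)
Lemma sqr_increment_le_energy (t : K) : 0 < t <= 1 ->
  (phi t - phi 0) ^+ 2 <= t * energy.
Proof.
move=> /andP[t0 t1].
pose l := (phi t - phi 0) / t.
have cphi'2 : continuous (fun s => (phi^`())%classic s ^+ 2).
  exact: continuous_sqr.
have caff : continuous (fun s => 2 * l * (phi^`())%classic s - l ^+ 2).
  exact: continuous_affine.
have lin :
    \int[mu]_(s in `]0, t[%classic) (2 * l * (phi^`())%classic s - l ^+ 2)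
    = 2 * l * (phi t - phi 0) - l ^+ 2 * t.
  have dF (s : K) : is_derive s 1 (fun s => 2 * l * phi s - l ^+ 2 * s)
      (2 * l * (phi^`())%classic s - l ^+ 2).
    have dphis : is_derive s 1 phi ('D_1 phi s) by exact: derivableP.
    rewrite derive1E; apply: is_derive_eq.
    by rewrite /GRing.scale /=; ring.
  by rewrite (Rintegral_derive1 _ _ t0 caff dF); ring.
(* A half-open interval splits at [t] without overlap. *)
have le_energy :
    \int[mu]_(s in `]0, t[%classic) (phi^`())%classic s ^+ 2 <= energy.
  have int_phi'2 b (bb : bool) :
      mu.-integrable [set` Interval (BRight 0) (BSide bb b)]
        (EFin \o (fun s => (phi^`())%classic s ^+ 2)).
    exact: continuous_integrable_itv.
  rewrite /energy (Rintegral_itv_bndo_bndc (int_phi'2 t true)).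
  rewrite (Rintegral_itv_bndo_bndc (int_phi'2 1 true)).
  rewrite -subr_ge0 Rintegral_itvB ?bnd_simp ?(ltW t0) //.
  by apply: Rintegral_ge0 => s _; exact: sqr_ge0.
have : \int[mu]_(s in `]0, t[%classic) (2 * l * (phi^`())%classic s - l ^+ 2)
    <= \int[mu]_(s in `]0, t[%classic) (phi^`())%classic s ^+ 2.
  apply: le_Rintegral => //.
  - exact: continuous_integrable_itv.
  - exact: continuous_integrable_itv.
  - by move=> s _; have := sqr_ge0 ((phi^`())%classic s - l); nra.
rewrite lin => /le_trans/(_ le_energy).
rewrite -(ler_pM2l t0); congr (_ <= _).
by rewrite /l; field; rewrite gt_eqF.
Qed.

(** From [(a + x) ^+ 2 <= 3/2 * a ^+ 2 + 3 * x ^+ 2] and the increment bound, whose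
    factor [t] integrates to 1/2. The uneven constants matter: the first is
    multiplied by 4 on vertices, so that the even split into 2 and 2 would exceed
    the constant 8 of the theorem when [S] has one element. *)
Lemma Rintegral_sqr_dev_le (c : K) :
  \int[mu]_(t in `]0, 1[%classic) (phi t - c) ^+ 2
  <= 3 / 2 * (phi 0 - c) ^+ 2 + 3 / 2 * energy.
Proof.
pose bound t := 3 * energy * t + 3 / 2 * (phi 0 - c) ^+ 2.
have cbound : continuous bound by apply: continuous_affine => t; exact: cvg_id.
have csqr : continuous (fun t => (phi t - c) ^+ 2).
  by apply: continuous_sqr => t; apply: cvgB; [exact: cphi|exact: cvg_cst].
have -> : 3 / 2 * (phi 0 - c) ^+ 2 + 3 / 2 * energy =
    \int[mu]_(t in `]0, 1[%classic) bound t.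
  have dF (t : K) : is_derive t 1
      (fun t => 3 / 2 * energy * t ^+ 2 + 3 / 2 * (phi 0 - c) ^+ 2 * t)
      (bound t).
    by apply: is_derive_eq; rewrite /GRing.scale /= /bound; field.
  by rewrite (Rintegral_derive1 _ _ ltr01 cbound dF); ring.
apply: le_Rintegral => //.
- exact: continuous_integrable_itv.
- exact: continuous_integrable_itv.
move=> t /=; rewrite in_itv /= => /andP[t0 /ltW t1].
have : (phi t - phi 0) ^+ 2 <= t * energy.
  by apply: sqr_increment_le_energy; rewrite t0.
rewrite /bound; set x := phi t - phi 0; set a := phi 0 - c => le_x.
have -> : phi t - c = a + x by rewrite /a /x; ring.
by have := sqr_ge0 (a - 2 * x); nra.
Qed.

Lemma Rintegral_sqr_dev (c : K) :
  \int[mu]_(t in `]0, 1[%classic) (phi t - c) ^+ 2 =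
  \int[mu]_(t in `]0, 1[%classic) phi t ^+ 2
  - 2 * c * \int[mu]_(t in `]0, 1[%classic) phi t + c ^+ 2.
Proof.
transitivity (\int[mu]_(t in `]0, 1[%classic)
    (phi t ^+ 2 + (- 2 * c * phi t + c ^+ 2))).
  by apply: eq_Rintegral => t _; ring.
have int_phi := continuous_integrable_itv 0 1 false true cphi.
have cphi_sqr := continuous_sqr cphi.
have cphi_aff := @continuous_affine _ (- 2 * c) (c ^+ 2) cphi.
rewrite RintegralD //; [|exact: continuous_integrable_itv..].
have cphi_lin : continuous (fun t => - 2 * c * phi t).
  by move=> t; apply: cvgMr; exact: cphi.
rewrite RintegralD //; [|apply: continuous_integrable_itv..]; last 2 first.
- exact: cphi_lin.
- exact: cst_continuous.
rewrite RintegralZl // Rintegral_cst //= lebesgue_measure_itv /= lte_fin ltr01.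
by rewrite oppr0 adde0 mulr1; ring.
Qed.

End EdgeCalculus.

(** * From vertices to the metric graph *)

Section Poincare.
Variables (K : realType) (G : groupType) (S : {fset G}).
Hypothesis genS : generates S.
Local Notation mu := (@lebesgue_measure K).

(** An oriented edge is determined by its tail and its letter, and there are at
    most [2 |S|] letters. *)
Lemma sum_edge_tail_le (F : G -> K) (n : nat) : (forall g, 0 <= F g) ->
  \sum_(e <- edge_fset S n) F e.1
  <= (2 * #|` S|)%:R * \sum_(g <- ball_fset S n) F g.
Proof.
move=> F0.
apply: (@le_trans _ _ (#|` letters S|%:R * \sum_(g <- ball_fset S n) F g));
  last first.
  by rewrite ler_wpM2r ?sumr_ge0 // ler_nat card_letters.
have -> : #|` letters S|%:R * \sum_(g <- ball_fset S n) F g =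
    \sum_(p <- (ball_fset S n `*` letters S)%fset) F p.1.
  rewrite [RHS]big_imfset2 /=; last by move=> [? ?] [? ?] _ _ /= [-> ->].
  rewrite mulr_sumr; apply: eq_bigr => g _.
  by rewrite sum_fset_const.
apply: (@ler_sum_fset_inj _ _ _ _ _ (fun e => (e.1, (e.1^-1 * e.2)%g))
  (fun p => F p.1)) => [[a b] [c d] _ _ /= [-> /mulgI ->]||[g h]] //.
case/in_edge_fsetP => // /= gh ghn.
rewrite in_fsetM /= in_letters in_ball_fset //.
have /cayley_adjP[_ ->] := gh; rewrite andbT => /negP[].
by have := word_norm_adj genS (cayley_adj_sym gh); move: ghn; lia.
Qed.

(** A quadratic polynomial is smallest at its critical point; here it is the
    integral of [(f - c) ^+ 2] as a function of [c], whose critical point is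
    the average of [f]. *)
Lemma sum_quadratic_min (I : choiceType) (A : {fset I}) (q l : I -> K) (c : K) :
  let m := (\sum_(i <- A) l i) / #|` A|%:R in
  \sum_(i <- A) (q i - 2 * m * l i + m ^+ 2)
  <= \sum_(i <- A) (q i - 2 * c * l i + c ^+ 2).
Proof.
set m := (_ / _) => /=.
have sumE x : \sum_(i <- A) (q i - 2 * x * l i + x ^+ 2) =
    \sum_(i <- A) q i - 2 * x * (\sum_(i <- A) l i) + #|` A|%:R * x ^+ 2.
  by rewrite big_split sumrB -mulr_sumr sum_fset_const.
rewrite !sumE.
have [A0|A_neq0] := eqVneq A fset0.
  by rewrite A0 !big_seq_fset0 cardfs0; lra.
have N0 : 0 < #|` A|%:R :> K by rewrite ltr0n cardfs_gt0.
have -> : \sum_(i <- A) l i = #|` A|%:R * m by rewrite mulrC divfK ?gt_eqF.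
have := sqr_ge0 (c - m); nra.
Qed.

Section SmoothFunction.
Variables (n : nat) (f : (G -> K) -> K).
Hypothesis smooth_f : smooth_on S (cayley_ball S n%:R) f.

Definition edge_energy (e : G * G) : K :=
  \int[mu]_(t in `]0, 1[%classic) grad_norm f e.1 e.2 t ^+ 2.

(** Inside the edge, [grad_norm] only sees [f] near the point, where it agrees
    with the smooth extension [phi]; outside of [[0, 1]] nothing is known of
    [f] along the line through the edge. *)
Lemma edge_profile (e : G * G) : e \in edge_fset S n ->
  exists phi : K -> K,
  [/\ forall t : K, derivable phi t 1,
      continuous (phi^`())%classic,
      forall t, 0 <= t <= 1 -> f (edge_point e.1 e.2 t) = phi t &
      energy phi = edge_energy e].
Proof.
case/in_edge_fsetP => // adj_e en.
have [phi smooth_phi f_phi] := smooth_f.2 _ _ adj_e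
  (fun t t01 => edge_point_in_ball genS adj_e en t01).
exists phi; split=> //.
- by move=> t; exact: (smooth_phi 0%N).
- by apply: derivable_continuous_at => t; exact: (smooth_phi 1%N).
apply: eq_Rintegral => t; rewrite inE /= => t01.
rewrite /grad_norm real_normK ?num_real // !derive1E; congr (_ ^+ 2).
apply: near_eq_derive.
have := near_in_itvoo t01; apply: filterS => u.
rewrite in_itv /= => /andP[u0 u1].
by rewrite f_phi // !ltW.
Qed.

Lemma sqr_increment_le_edge_energy (e : G * G) : e \in edge_fset S n ->
  (f (vertex K e.2) - f (vertex K e.1)) ^+ 2 <= edge_energy e.
Proof.
move=> /edge_profile[phi [dphi cphi' f_phi <-]].
rewrite -(edge_point1 _ e.1 e.2) -(edge_point0 _ e.1 e.2).
rewrite !f_phi ?lexx ?ler01 //.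
rewrite -[energy phi]mul1r.
by apply: sqr_increment_le_energy; rewrite ?ltr01 ?lexx.
Qed.

Lemma edge_sqr_dev_le (e : G * G) (c : K) : e \in edge_fset S n ->
  \int[mu]_(t in `]0, 1[%classic) (f (edge_point e.1 e.2 t) - c) ^+ 2
  <= 3 / 2 * (f (vertex K e.1) - c) ^+ 2 + 3 / 2 * edge_energy e.
Proof.
move=> /edge_profile[phi [dphi cphi' f_phi <-]].
rewrite -(edge_point0 _ e.1 e.2) f_phi ?lexx ?ler01 //.
under eq_Rintegral.
  move=> t; rewrite inE /= in_itv /= => /andP[t0 t1]; rewrite f_phi ?ltW //; over.
exact: Rintegral_sqr_dev_le.
Qed.

Lemma edge_sqr_dev (e : G * G) (c : K) : e \in edge_fset S n ->
  \int[mu]_(t in `]0, 1[%classic) (f (edge_point e.1 e.2 t) - c) ^+ 2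
  = \int[mu]_(t in `]0, 1[%classic) f (edge_point e.1 e.2 t) ^+ 2
    - 2 * c * \int[mu]_(t in `]0, 1[%classic) f (edge_point e.1 e.2 t) + c ^+ 2.
Proof.
move=> /edge_profile[phi [dphi cphi' f_phi _]].
have eqI (F : K -> K) :
    \int[mu]_(t in `]0, 1[%classic) F (f (edge_point e.1 e.2 t)) =
    \int[mu]_(t in `]0, 1[%classic) F (phi t).
  apply: eq_Rintegral => t; rewrite inE /= in_itv /= => /andP[t0 t1].
  by rewrite f_phi ?ltW.
rewrite (eqI (fun x => (x - c) ^+ 2)) (eqI (fun x => x ^+ 2)) (eqI id).
exact: Rintegral_sqr_dev.
Qed.

(** The average minimizes the mean square deviation, so that [c] can later be
    the mean over vertices, which is different in general. *)
Lemma sum_sqr_dev_average_le (R : nat) (c : K) : (R <= n)%N ->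
  arclength_integral S (cayley_ball S R%:R)
    (fun x => `|f x - average S (cayley_ball S R%:R) f| ^+ 2)
  <= 2^-1 * \sum_(e <- edge_fset S R)
       \int[mu]_(t in `]0, 1[%classic) (f (edge_point e.1 e.2 t) - c) ^+ 2.
Proof.
move=> Rn; rewrite /average /total_length /arclength_integral.
rewrite !edge_integral_ball //.
rewrite ler_pM2l ?invr_gt0 //.
have -> : \sum_(e <- edge_fset S R) \int[mu]_(t in `]0, 1[%classic) 1
    = #|` edge_fset S R|%:R :> K.
  under eq_bigr do rewrite Rintegral_cst //= lebesgue_measure_itv /= lte_fin ltr01.
  by rewrite sum_fset_const /= oppr0 addr0 !mulr1.
rewrite invfM mulrACA mulfV ?mul1r ?invr_eq0 ?pnatr_eq0 //.
under eq_bigr do under eq_Rintegral do rewrite real_normK ?num_real //.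
have sub e : e \in edge_fset S R -> e \in edge_fset S n.
  by move: e; apply/fsubsetP; exact: edge_fsetS.
have sumE x : \sum_(e <- edge_fset S R)
      \int[mu]_(t in `]0, 1[%classic) (f (edge_point e.1 e.2 t) - x) ^+ 2
    = \sum_(e <- edge_fset S R)
       (\int[mu]_(t in `]0, 1[%classic) f (edge_point e.1 e.2 t) ^+ 2
       - 2 * x * \int[mu]_(t in `]0, 1[%classic) f (edge_point e.1 e.2 t)
       + x ^+ 2).
  by rewrite big_seq [RHS]big_seq; apply: eq_bigr => e /sub; exact: edge_sqr_dev.
by rewrite !sumE; exact: sum_quadratic_min.
Qed.

End SmoothFunction.

End Poincare.

Theorem theorem2p2 (K : realType) (G : groupType) (S : {fset G})
  (hS : generates S) (R : nat) (f : (G -> K) -> K)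
  (hf : smooth_on S (cayley_ball S (3 * R)%:R) f) :
  arclength_integral S (cayley_ball S R%:R)
    (fun x => `|f x - average S (cayley_ball S R%:R) f| ^+ 2)
  <= 8 * #|` S|%:R ^+ 2 * R%:R ^+ 2
     * ((volume S (2 * R))%:R / (volume S R)%:R)
     * edge_integral S (cayley_ball S (3 * R)%:R)
         (fun g h t => grad_norm f g h t ^+ 2).
Proof.
pose U x := f (vertex K x).
pose c := (\sum_(y <- ball_fset S R) U y) / (volume S R)%:R.
have le_R : (R <= 3 * R)%N by lia.
apply: le_trans (sum_sqr_dev_average_le hS hf c le_R) _.
rewrite edge_integral_ball //.
pose D := \sum_(e <- edge_fset S (3 * R)) edge_energy f e.
rewrite -[X in _ <= _ * (_ * X)]/D.
set rho := (_ / _).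
have rho1 : 1 <= rho.
  by rewrite ler_pdivlMr ?ltr0n ?volume_gt0 // mul1r ler_nat volumeS //; lia.
have energy0 e : 0 <= edge_energy f e.
  by apply: Rintegral_ge0 => t _; exact: sqr_ge0.
have D0 : 0 <= D by apply: sumr_ge0 => e _; exact: energy0.
have [no_edge|[e0]] := fset_0Vmem (edge_fset S R).
  rewrite no_edge big_seq_fset0 mulr0.
  rewrite !mulr_ge0 // ?invr_ge0 ?exprn_ge0 ?ler0n //; lra.
case/in_edge_fsetP => // -[_ [s Ss _]] e0R.
have S1 : 1 <= #|` S|%:R :> K.
  by rewrite ler1n cardfs_gt0; apply/fset0Pn; exists s.
have R1 : 1 <= R%:R :> K by rewrite ler1n; move: e0R; case: (R).
have dev_le : \sum_(e <- edge_fset S R)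
      \int[lebesgue_measure]_(t in `]0, 1[%classic)
        (f (edge_point e.1 e.2 t) - c) ^+ 2
    <= 3 / 2 * ((2 * #|` S|)%:R * \sum_(x <- ball_fset S R) (U x - c) ^+ 2)
       + 3 / 2 * D.
  apply: (@le_trans _ _ (\sum_(e <- edge_fset S R)
    (3 / 2 * (U e.1 - c) ^+ 2 + 3 / 2 * edge_energy f e))).
    rewrite big_seq [leRHS]big_seq; apply: ler_sum => e eR.
    apply: (edge_sqr_dev_le hS hf).
    by move: e eR; apply/fsubsetP; exact: edge_fsetS.
  rewrite big_split -!mulr_sumr lerD // ler_wpM2l //.
    apply: (sum_edge_tail_le hS (F := fun x => (U x - c) ^+ 2)) => x.
    exact: sqr_ge0.
  apply: (@ler_sum_fset_inj _ _ _ _ _ id) => // e eR /negP[].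
  by move: e eR; apply/fsubsetP; exact: edge_fsetS.
have vertex_le :
    \sum_(x <- ball_fset S R) (U x - c) ^+ 2 <= 2 * R%:R ^+ 2 * rho * D.
  apply: le_trans (discrete_poincare hS U R) _.
  apply: ler_wpM2l.
    by rewrite -/rho mulr_ge0 ?mulr_ge0 ?exprn_ge0 ?ler0n //; lra.
  rewrite /D big_seq [leRHS]big_seq; apply: ler_sum => e eR.
  exact: (sqr_increment_le_edge_energy hS hf).
rewrite mulrCA ler_pM2l ?invr_gt0 //.
apply: (le_trans dev_le).
rewrite natrM.
move: vertex_le S1 R1; rewrite -/rho.
move: (\sum_(x <- _) _) (#|` S|%:R : K) (R%:R : K) => V a r vertex_le a1 r1.
have P1 : 1 <= r ^+ 2 * rho by rewrite mulr_ege1 // exprn_ege1.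
have -> : 8 * a ^+ 2 * r ^+ 2 * rho * D
    = 8 * a ^+ 2 * (r ^+ 2 * rho) * D by ring.
have {}vertex_le : V <= 2 * (r ^+ 2 * rho) * D by rewrite mulrA.
move: (r ^+ 2 * rho) P1 vertex_le => P P1 vertex_le.
have aP1 : 1 <= a * P by rewrite mulr_ege1.
(* The left-hand side is at most [(6 * a * P + 3 / 2) * D], and [1 <= a * P]. *)
apply: (@le_trans _ _ (8 * (a * P) * D)); last first.
  by rewrite ler_wpM2r //; nra.
have aV : a * V <= 2 * (a * P) * D.
  have -> : 2 * (a * P) * D = a * (2 * P * D) by ring.
  by rewrite ler_wpM2l //; lra.
have PD : D <= a * P * D by rewrite ler_peMl.
lra.
Qed.
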